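(* Let $\mathbb{X}=(X,\mathcal{M},\mu)$ be a nontrivial semifinite measure space with a collection of generators $\mathscr{G}$. If $\mathscr{G}$ is a Denjoy family, then $\mathrm{BMO}_{\mathscr{G}}(\mathbb{X})$ has the John-Nirenberg property.
   Context: Setting: $\mathbb{X}=(X,\mathcal{M},\mu)$ is a nontrivial (i.e. $\mu(X)>0$) semifinite measure space, $\mathcal{M}^*=\{E\in\mathcal{M}:0<\mu(E)<\infty\}$, and the collection of generators $\mathscr{G}\subset\mathcal{M}^*$ covers $X$. $L^1_{\mathrm{loc}}(\mathbb{X},\mathscr{G})$ is the space of measurable $f:X\to\mathbb{R}$ with $\int_G|f|\,d\mu<\infty$ for every $G\in\mathscr{G}$; $f_G=\frac1{\mu(G)}\int_G f\,d\mu$. $\mathrm{BMO}_{\mathscr{G}}(\mathbb{X})$ is the set of $f\in L^1_{\mathrm{loc}}(\mathbb{X},\mathscr{G})$ with $\|f\|_{\mathrm{BMO}_{\mathscr{G}}(\mathbb{X})}=\sup_{G\in\mathscr{G}}\frac1{\mu(G)}\int_G|f-f_G|\,d\mu<\infty$. John-Nirenberg property (JNP): there exist $c_1,c_2>0$ such that for every $f\in\mathrm{BMO}_{\mathscr{G}}(\mathbb{X})$, every $G\in\mathscr{G}$ and every $t>0$, $$\frac{\mu(\{x\in G:|f(x)-f_G|>t\})}{\mu(G)}\le c_1\exp\left(\frac{-c_2}{\|f\|_{\mathrm{BMO}_{\mathscr{G}}(\mathbb{X})}}t\right),$$ where the right-hand side is read as $0$ if $\|f\|_{\mathrm{BMO}_{\mathscr{G}}(\mathbb{X})}=0$.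 Notation: $\mathscr{G}(x)=\{G\in\mathscr{G}:x\in G\}$. A sequence $\{G_n\}\subset\mathscr{G}(x)$ converges to $x$, written $G_n\to x$, if $\mu(G_n)\to0$. Also $\limsup_{G\to x}\frac1{\mu(G)}\int_G|f|\,d\mu:=\lim_{\varepsilon\to0}\sup\{\frac1{\mu(G)}\int_G|f|\,d\mu: G\in\mathscr{G}(x),\ \mu(G)<\varepsilon\}$. The outer measure is $\mu^*(A)=\inf\{\mu(E):A\subset E\in\mathcal{M}\}$. For $a>1$ and $A\subset X$, $\Omega_a(A)=\bigcup\{G\in\mathscr{G}:G\cap A\ne\emptyset,\ \mu(G)\le a\mu^*(A)\}$, and $\Omega_a^{(j)}$ is the $j$-th iterate of $\Omega_a$. For $1<a\le b$, a generator $G'\in\mathscr{G}$ is an $(a,b)$-Denjoy double of $G\in\mathscr{G}$ if $\Omega_a(G)\subset G'$ and $\mu(G')\le b\mu(G)$. $\mathscr{G}$ is a Denjoy family if: - (Shrinking) for almost every $x\in X$ there is a sequence $\{G_n\}\subset\mathscr{G}(x)$ with $G_n\to x$; - (Denjoy doubling) there are uniform constants $1<a\le b$ such that every $G\in\mathscr{G}$ has an $(a,b)$-Denjoy double; - (Growth) for any $G_0,G\in\mathscr{G}$ with $G\cap G_0\ne\emptyset$ there is $j\in\mathbb{N}$ with $\mu^*(\Omega_a^{(j)}(G))\ge\frac ab\mu(G_0)$; - (Weak differentiation) for every $f\in L^1_{\mathrm{loc}}(\mathbb{X},\mathscr{G})$, for almost every $x\in X$, $|f(x)|\le\limsup_{G\to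 x}\frac1{\mu(G)}\int_G|f|\,d\mu$. *)

(* Defs.v *)
From HB Require Import structures.
From mathcomp Require Import all_boot all_order all_algebra.
From mathcomp Require Import all_classical all_reals all_analysis.
Set Implicit Arguments.
Unset Strict Implicit.
Unset Printing Implicit Defensive.
Import Order.TTheory GRing.Theory Num.Theory.
Import numFieldNormedType.Exports.
Local Open Scope classical_set_scope.
Local Open Scope ring_scope.
Local Open Scope ereal_scope.

Definition semifinite (d : measure_display) (T : measurableType d)
    (R : realType) (mu : {measure set T -> \bar R}) : Prop :=
  forall E : set T, measurable E -> mu E = +oo ->
    exists F : set T, [/\ measurable F, F `<=` E, 0 < mu F & mu F < +oo].

Definition finite_positive (d : measure_display) (T : measurableType d)
    (R : realType) (mu : {measure set T -> \bar R}) : set (set T) :=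
  [set E | [/\ measurable E, 0 < mu E & mu E < +oo]].

Definition generators (d : measure_display) (T : measurableType d)
    (R : realType) (mu : {measure set T -> \bar R}) (GG : set (set T)) : Prop :=
  GG `<=` finite_positive mu /\ \bigcup_(G in GG) G = [set: T].

Definition L1loc (d : measure_display) (T : measurableType d)
    (R : realType) (mu : {measure set T -> \bar R}) (GG : set (set T)) :
    set (T -> R) :=
  [set f : T -> R | measurable_fun [set: T] f /\
    forall G, GG G -> \int[mu]_(x in G) `|f x|%:E < +oo].

(* The average of f over G; it is only used for f integrable on G and
   0 < mu G < +oo, where `fine` and the real-valued integral lose nothing. *)
Definition avg (d : measure_display) (T : measurableType d)
    (R : realType) (mu : {measure set T -> \bar R}) (f : T -> R)
    (G : set T) : R :=
  ((fine (mu G))^-1 * \int[mu]_(x in G) f x)%R.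

Definition avg_abs (d : measure_display) (T : measurableType d)
    (R : realType) (mu : {measure set T -> \bar R}) (f : T -> R)
    (G : set T) : \bar R :=
  (mu G)^-1 * \int[mu]_(x in G) `|f x|%:E.

Definition BMO_norm (d : measure_display) (T : measurableType d)
    (R : realType) (mu : {measure set T -> \bar R}) (GG : set (set T))
    (f : T -> R) : \bar R :=
  ereal_sup [set avg_abs mu (fun x => f x - avg mu f G)%R G | G in GG].

Definition BMO (d : measure_display) (T : measurableType d)
    (R : realType) (mu : {measure set T -> \bar R}) (GG : set (set T)) :
    set (T -> R) :=
  [set f : T -> R | L1loc mu GG f /\ BMO_norm mu GG f < +oo].

(* Division by 0 is 0 in a field, so the right-hand side has to be set
   to 0 by hand when the norm vanishes. *)
Definition John_Nirenberg (d : measure_display) (T : measurableType d)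
    (R : realType) (mu : {measure set T -> \bar R}) (GG : set (set T)) : Prop :=
  exists c1 c2 : R, [/\ (0 < c1)%R, (0 < c2)%R &
    forall f : T -> R, BMO mu GG f ->
    forall G : set T, GG G -> forall t : R, (0 < t)%R ->
      mu [set x | G x /\ (t < `|f x - avg mu f G|)%R] / mu G <=
        if BMO_norm mu GG f == 0 then 0
        else (c1 * expR (- c2 / fine (BMO_norm mu GG f) * t))%:E].

Definition generators_at (T : Type) (GG : set (set T)) (x : T) : set (set T) :=
  [set G | GG G /\ G x].

(* When no generator at x has measure less than e the supremum is -oo; under
   the shrinking condition this happens only for x in a negligible set. *)
Definition limsup_avg_abs (d : measure_display) (T : measurableType d)
    (R : realType) (mu : {measure set T -> \bar R}) (GG : set (set T))
    (f : T -> R) (x : T) : \bar R :=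
  lim (ereal_sup [set avg_abs mu f G | G in
         [set G | generators_at GG x G /\ mu G < e%:E]] @[e --> (0 : R)^'+]).

Definition outer (d : measure_display) (T : measurableType d)
    (R : realType) (mu : {measure set T -> \bar R}) (A : set T) : \bar R :=
  ereal_inf [set mu E | E in [set E | measurable E /\ A `<=` E]].

Definition Omega (d : measure_display) (T : measurableType d)
    (R : realType) (mu : {measure set T -> \bar R}) (GG : set (set T))
    (a : R) (A : set T) : set T :=
  \bigcup_(G in [set G | [/\ GG G, G `&` A !=set0 &
                             mu G <= a%:E * outer mu A]]) G.

Definition Denjoy_double (d : measure_display) (T : measurableType d)
    (R : realType) (mu : {measure set T -> \bar R}) (GG : set (set T))
    (a b : R) (G G' : set T) : Prop :=
  [/\ GG G', Omega mu GG a G `<=` G' & mu G' <= b%:E * mu G].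

Definition shrinking (d : measure_display) (T : measurableType d)
    (R : realType) (mu : {measure set T -> \bar R}) (GG : set (set T)) : Prop :=
  {ae mu, forall x, exists G_ : nat -> set T,
    (forall n, generators_at GG x (G_ n)) /\ mu (G_ n) @[n --> \oo] --> 0}.

Definition Denjoy_doubling (d : measure_display) (T : measurableType d)
    (R : realType) (mu : {measure set T -> \bar R}) (GG : set (set T))
    (a b : R) : Prop :=
  forall G, GG G -> exists G', Denjoy_double mu GG a b G G'.

(* Allowing j = 0 is harmless: a generator G is contained in Omega a G, so
   j = 0 can be replaced by j = 1. *)
Definition growth (d : measure_display) (T : measurableType d)
    (R : realType) (mu : {measure set T -> \bar R}) (GG : set (set T))
    (a b : R) : Prop :=
  forall G0 G, GG G0 -> GG G -> G `&` G0 !=set0 ->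
    exists j : nat, (a / b)%:E * mu G0 <= outer mu (iter j (Omega mu GG a) G).

Definition weak_differentiation (d : measure_display) (T : measurableType d)
    (R : realType) (mu : {measure set T -> \bar R}) (GG : set (set T)) : Prop :=
  forall f : T -> R, L1loc mu GG f ->
    {ae mu, forall x, `|f x|%:E <= limsup_avg_abs mu GG f x}.

Definition Denjoy_family (d : measure_display) (T : measurableType d)
    (R : realType) (mu : {measure set T -> \bar R}) (GG : set (set T)) : Prop :=
  [/\ shrinking mu GG,
      exists a b : R, [/\ (1 < a)%R, (a <= b)%R,
        Denjoy_doubling mu GG a b & growth mu GG a b] &
      weak_differentiation mu GG].

(* Main.v *)
Require Import Defs.
From HB Require Import structures.
From mathcomp Require Import all_boot all_order all_algebra.
From mathcomp Require Import all_classical all_reals all_analysis.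
From mathcomp Require Import measurable_realfun ring lra.
(** The proof is a Calderon-Zygmund argument in which Denjoy doubles play the
    part of dilated balls.  Fix [f] with BMO norm [B], a generator [G0], and
    write [c] for the mean of [f] over [G0].  By weak differentiation almost
    every point of [G0] with [l < |f - c|] lies in an arbitrarily small
    generator on which the mean of [|f - c|] exceeds [l].  Pass repeatedly to
    Denjoy doubles: by the growth condition the measure eventually reaches
    [(a / b) * mu G0], and the first time it does so it is still at most
    [a * mu G0], so that this generator sits inside the double of [G0], where
    the integral of [|f - c|] is at most [b * (1 + b) * B * mu G0]
    ([double_oscillation]).  Hence for [l] of the order of [B] the mean has
    dropped below [l] by then, and somewhere along the chain a generator has
    mean above [l] while its double has mean at most [l] ([stopping_double]).

    From these stopping generators a greedy Vitali selection
    ([vitali_selection]) extracts a disjoint sequence [C_n] such that the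
    doubles of the [C_n] cover all of them: a generator meeting [C_n] and of
    measure at most [a * mu (C_n)] is contained in every Denjoy double of
    [C_n], by definition.  Disjointness gives
    [l * sum mu (C_n) <= b * (1 + b) * B * mu G0], and on the double [E_n] of
    [C_n] the mean of [f] differs from [c] by at most [l]
    ([calderon_zygmund_cover]).  So a deviation larger than [s + l] from the
    mean over [G0] forces a deviation larger than [s] from the mean over some
    [E_n]; with [l = 2 * b ^ 2 * (1 + b) * B] this halves the bound on the
    relative measure of the deviation set ([deviation_step]).  Iterating
    ([deviation_decay]) gives decay like [2 ^ - n] at [t = n * l], which is
    the John-Nirenberg inequality with [c1 = 2] and
    [c2 = ln 2 / (2 * b ^ 2 * (1 + b))]. *)

Set Implicit Arguments.
Unset Strict Implicit.
Unset Printing Implicit Defensive.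
Import Order.TTheory GRing.Theory Num.Theory.
Local Open Scope classical_set_scope.
Local Open Scope ring_scope.
Local Open Scope ereal_scope.

(** * Vitali selection *)

Section covering.
Context {d : measure_display} {T : measurableType d} {R : realType}.
Variable mu : {measure set T -> \bar R}.
Implicit Types (A G H U : set T) (F : set (set T)) (a : R).

Lemma trivIset_bounded_measure_lt (C : nat -> set T) H (e : R) :
  (forall n, measurable (C n)) -> trivIset [set: nat] C ->
  measurable H -> mu H < +oo -> (forall n, C n `<=` H) ->
  (0 < e)%R -> exists n, mu (C n) < e%:E.
Proof.
move=> mC tC mH Hfin CH e0; apply: contrapT => /forallNP Cge.
have mHfin : mu H \is a fin_num by rewrite ge0_fin_numE.
have bound n : (e *+ n <= fine (mu H))%R.
  rewrite -lee_fin fineK//.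
  apply: (@le_trans _ _ (mu (\big[setU/set0]_(i < n) C i))); last first.
    apply: le_measure; rewrite ?inE//.
      exact: bigsetU_measurable.
    by rewrite -bigcup_mkord => x [i _ /CH].
  rewrite measure_bigsetU//.
  rewrite -[n in (e *+ n)%R]card_ord -sumr_const -sumEFin.
  by apply: lee_sum => i _; rewrite leNgt; apply/negP/Cge.
have := bound (Num.truncn (fine (mu H) / e)).+1.
rewrite -mulr_natl -ler_pdivlMr// leNgt.
by rewrite truncnS_gt.
Qed.

(** Greedy selection: [C n] is chosen among the members of [F] disjoint from
    the earlier choices, with measure more than [1 / a] times the supremum of
    the measures available, or is empty when nothing is available.  A member
    [G] of [F] cannot remain available forever, since then
    [mu G <= a * mu (C n)] for all [n] while [mu (C n)] gets arbitrarily
    small; the first choice that [G] meets was made while [G] was available,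
    hence has measure at least [mu G / a]. *)
Lemma vitali_selection F H a : (1 < a)%R -> measurable H -> mu H < +oo ->
  (forall G, F G -> [/\ measurable G, 0 < mu G & G `<=` H]) ->
  exists C : nat -> set T,
    [/\ trivIset [set: nat] C, forall n, F (C n) \/ C n = set0 &
      forall G, F G -> exists n,
        [/\ F (C n), G `&` C n !=set0 & mu G <= a%:E * mu (C n)]].
Proof.
move=> a1 mH Hfin Fprop.
have a0 : (0 < a)%R by exact: lt_trans a1.
pose avail U := [set G | F G /\ G `&` U = set0].
have pickP U : exists P, (avail U P /\ forall G, avail U G -> mu G <= a%:E * mu P)
    \/ (P = set0 /\ avail U = set0).
  have [/eqP av0|/set0P[G1 av1]] := boolP (avail U == set0).
    by exists set0; right.
  pose s := ereal_sup [set mu G | G in avail U].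
  have G1s : mu G1 <= s by apply: ereal_sup_ubound; exists G1.
  have s0 : 0 < s by apply: lt_le_trans G1s; case: (Fprop _ av1.1).
  have soo : s < +oo.
    apply: le_lt_trans Hfin; apply: ge_ereal_sup => _ [G [FG _] <-].
    by have [mG _ GH] := Fprop _ FG; apply: le_measure; rewrite ?inE.
  have [r sE] : exists r, s = r%:E.
    by exists (fine s); rewrite fineK// ge0_fin_numE// ltW.
  have r0 : (0 < r)%R by rewrite -lte_fin -sE.
  have : (a^-1 * r)%:E < s.
    by rewrite sE lte_fin gtr_pMl// invf_lt1.
  case/ereal_sup_gt => _ [P avP <-] rP.
  exists P; left; split=> // G avG.
  have /le_trans : mu G <= s by apply: ereal_sup_ubound; exists G.
  by apply; rewrite sE -lee_pdivrMl// -EFinM ltW.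
have [p pP] := choice pickP.
pose U := fix U n := if n is m.+1 then U m `|` p (U m) else set0.
pose C n := p (U n).
have CU m n : (m < n)%N -> C m `<=` U n.
  elim: n => // n IH; rewrite ltnS leq_eqVlt => /predU1P[-> |/IH CUn] x Cx /=.
    by right.
  by left; apply: CUn.
have CUn n : C n `&` U n = set0.
  by rewrite /C; case: (pP (U n)) => [[[]]//|[-> _]]; rewrite set0I.
have FC n : F (C n) \/ C n = set0.
  by rewrite /C; case: (pP (U n)) => [[[]]//|[-> _]]; [left|right].
have mC n : measurable (C n).
  by case: (FC n) => [/Fprop[]//|->].
have tC : trivIset [set: nat] C.
  apply/trivIsetP => i j _ _.
  wlog ij : i j / (i < j)%N.
    move=> wl; case: ltngtP => // ij _; first by apply: wl => //; rewrite ltn_eqF.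
    by rewrite setIC; apply: wl => //; rewrite ltn_eqF.
  move=> _; rewrite -subset0 -(CUn j) => x [Cix Cjx]; split=> //.
  exact: CU Cix.
exists C; split=> // G FG.
have [mG G0 GH] := Fprop _ FG.
have Gfin : mu G \is a fin_num.
  by rewrite ge0_fin_numE//; apply: le_lt_trans Hfin; apply: le_measure; rewrite ?inE.
(* [G] meets some [U n]: otherwise it stays available at every stage. *)
have [n0 GUn0] : exists n, `[< G `&` U n !=set0 >].
  apply: contrapT => /forallNP GU.
  have [||n Cn] := @trivIset_bounded_measure_lt C H (a^-1 * fine (mu G)) mC tC mH Hfin.
    by move=> n; case: (FC n) => [/Fprop[]//|->].
  - rewrite mulr_gt0 ?invr_gt0 ?fine_gt0// G0.
    by rewrite -ge0_fin_numE.
  - have avG : avail (U n) G.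
      split=> //; apply/eqP/negP => GUn; apply: (GU n); apply/asboolP.
      by apply/set0P/negP.
    case: (pP (U n)) => [[_ /(_ _ avG)]|[_ av0]]; last by rewrite av0 in avG.
    apply/negP; rewrite -ltNge.
    by move: Cn; rewrite EFinM fineK// lte_pdivlMl.
(* At the least such index, [n.+1], [G] meets [C n] but not [U n]. *)
have [[|n] /asboolP GUn nmin] :=
  ex_minnP (ex_intro (fun n => `[< G `&` U n !=set0 >]) n0 GUn0).
  by case: GUn => x [].
have GU0 : G `&` U n = set0.
  apply/eqP/negP => GUn'.
  suff /nmin : `[< G `&` U n !=set0 >] by rewrite ltnn.
  by apply/asboolP/set0P/negP.
have avG : avail (U n) G by [].
exists n; case: (pP (U n)) => [[[FCn _] /(_ _ avG)] leG|[_ av0]].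
  split=> //; case: GUn => x [Gx [Ux|Cx]]; last by exists x.
  by suff : set0 x by []; rewrite -GU0.
by rewrite av0 in avG.
Qed.

End covering.

(** * Iterated Denjoy doubles *)

Section doubles.
Context {d : measure_display} {T : measurableType d} {R : realType}.
Variables (mu : {measure set T -> \bar R}) (GG : set (set T)) (a b : R).
Implicit Types (A B G : set T).

Lemma outer_mono A B : A `<=` B -> outer mu A <= outer mu B.
Proof.
move=> AB; apply: ereal_inf_le_tmp => _ [E [mE BE] <-]; exists E => //.
by split=> // x /AB/BE.
Qed.

Lemma outer_measurable A : measurable A -> outer mu A = mu A.
Proof.
move=> mA; apply/eqP; rewrite eq_le; apply/andP; split.
  by apply: ereal_inf_lbound; exists A => //; split.
apply/ereal_infP => _ [E [mE AE] <-].
by apply: le_measure; rewrite ?inE.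
Qed.

Lemma Omega_mono A B : (0 <= a)%R -> A `<=` B ->
  Omega mu GG a A `<=` Omega mu GG a B.
Proof.
move=> a0 AB x [G [GGG [y [Gy Ay]] leG] Gx]; exists G => //; split => //.
  by exists y; split=> //; apply: AB.
by apply: le_trans leG _; apply: lee_wpmul2l; [rewrite lee_fin|exact: outer_mono].
Qed.

Hypotheses (a1 : (1 < a)%R) (ab : (a <= b)%R).
Hypothesis GG_gen : GG `<=` finite_positive mu.
Variable D : set T -> set T.
Hypothesis DP : forall G, GG G -> Denjoy_double mu GG a b G (D G).

(** This is how Denjoy doubles replace the dilated balls of the metric
    theory: [G1] is one of the generators whose union is [Omega a G]. *)
Lemma small_subset_double G G1 : GG G -> GG G1 -> G1 `&` G !=set0 ->
  mu G1 <= a%:E * mu G -> G1 `<=` D G.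
Proof.
move=> gG gG1 GG1 le1 x G1x; have [_ sub _] := DP gG; apply: sub.
exists G1 => //; split => //.
by rewrite outer_measurable//; case: (GG_gen gG).
Qed.

Lemma subset_double G : GG G -> G `<=` D G.
Proof.
move=> gG x Gx; have [mG G0 Goo] := GG_gen gG.
apply: (@small_subset_double G G) => //; first by exists x.
by rewrite -[leLHS]mul1e lee_wpmul2r// lee_fin ltW.
Qed.

Lemma iter_double G n : GG G -> GG (iter n D G).
Proof. by move=> gG; elim: n => // n /DP[]. Qed.

Lemma iter_Omega_subset_double G n : GG G ->
  iter n (Omega mu GG a) G `<=` iter n D G.
Proof.
move=> gG; elim: n => // n IH /= x Ox.
have [_ sub _] := DP (@iter_double _ n gG); apply: sub; apply: Omega_mono Ox => //.
by rewrite ltW// (lt_trans _ a1).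
Qed.

Lemma subset_iter_double G n : GG G -> G `<=` iter n D G.
Proof.
move=> gG; elim: n => // n IH x Gx /=.
by apply: subset_double; [exact: iter_double|exact: IH].
Qed.

(** Stopping time along the chain of iterated doubles of [G].  By growth the
    chain reaches measure [(a / b) * mu G0], since its [n]-th term contains
    the [n]-th iterate of [Omega]; let [j] be the first index where it does.
    The preceding term is smaller than [(a / b) * mu G0], so one doubling
    cannot exceed [a * mu G0] and [P] fails at [j].  The last index before
    the first failure of [P] is the required stopping point. *)
Lemma stopping_double (P : set T -> Prop) G0 G :
  growth mu GG a b -> GG G0 -> GG G -> G `&` G0 !=set0 ->
  mu G < (a / b)%:E * mu G0 -> P G ->
  (forall G1, GG G1 -> G1 `&` G0 !=set0 ->
    (a / b)%:E * mu G0 <= mu G1 -> mu G1 <= a%:E * mu G0 -> ~ P G1) ->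
  exists G1, [/\ GG G1, G `<=` G1, mu G1 <= (a / b)%:E * mu G0, P G1 & ~ P (D G1)].
Proof.
move=> gr gG0 gG [z [Gz G0z]] Gsmall PG nP.
have b0 : (0 < b)%R by rewrite (lt_le_trans _ ab)// (lt_trans _ a1).
pose large n := (a / b)%:E * mu G0 <= mu (iter n D G).
have exlarge : exists n, large n.
  have [|n le_n] := gr G0 G gG0 gG; first by exists z.
  exists n; apply: le_trans le_n _.
  have [mGn _ _] := GG_gen (@iter_double _ n gG).
  by rewrite -(outer_measurable mGn); apply/outer_mono/iter_Omega_subset_double.
have [j jlarge jmin] := ex_minnP exlarge.
have lt_small k : (k < j)%N -> mu (iter k D G) < (a / b)%:E * mu G0.
  by move=> kj; rewrite ltNge; apply/negP => /jmin; rewrite leqNgt kj.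
have nPj : `[< ~ P (iter j D G) >].
  apply/asboolP; apply: nP => //; first exact: iter_double.
    by exists z; split=> //; apply: subset_iter_double.
  case: j jlarge jmin lt_small => [|j] jlarge _ lt_small.
    by move: jlarge; rewrite /large leNgt Gsmall.
  have [_ _ /=/le_trans->//] := DP (@iter_double _ j gG).
  have -> : a%:E * mu G0 = b%:E * ((a / b)%:E * mu G0).
    by rewrite muleA -EFinM mulrCA mulfV ?mulr1// gt_eqF.
  by rewrite lee_wpmul2l ?lee_fin ?(ltW b0)//; apply/ltW/lt_small.
have [[|i] /asboolP nPi imin] :=
  ex_minnP (ex_intro (fun n => `[< ~ P (iter n D G) >]) j nPj); first by [].
exists (iter i D G); split => //.
- exact: iter_double.
- exact: subset_iter_double.
- exact/ltW/lt_small/(imin j nPj).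
- apply: contrapT => nPi'.
  have /imin : `[< ~ P (iter i D G) >] by exact/asboolP.
  by rewrite ltnn.
Qed.

End doubles.

(** * Averages and oscillation *)

Section oscillation.
Context {d : measure_display} {T : measurableType d} {R : realType}.
Variables (mu : {measure set T -> \bar R}) (GG : set (set T)).
Implicit Types (f : T -> R) (G : set T) (c t : R).

(** The suprema defining the upper limit decrease with the radius, so the
    limit is their infimum and is below the supremum at [e]. *)
Lemma limsup_avg_abs_gt f (x : T) (l e : R) : (0 < e)%R ->
  l%:E < limsup_avg_abs mu GG f x ->
  exists G, [/\ GG G, G x, mu G < e%:E & l%:E < avg_abs mu f G].
Proof.
move=> e0; rewrite /limsup_avg_abs.
set phi := fun e : R => ereal_sup _.
have phi_nd : {in `]0%R, +oo[ &, {homo phi : u v / (u <= v)%R >-> u <= v}}.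
  move=> u v _ _ uv; apply: ereal_sup_le => _ [G [Gx Gu] <-].
  by exists G => //; split => //; apply: lt_le_trans Gu _; rewrite lee_fin.
have /(_ isT) phi_cvg := nondecreasing_at_right_cvge _ _ phi_nd.
rewrite (cvg_lim _ phi_cvg)//.
move=> ltl.
have : l%:E < phi e.
  apply: lt_le_trans ltl _; apply: ge_ereal_inf; exists (phi e) => //.
  by exists e => //=; rewrite in_itv/= e0.
by move=> /ereal_sup_gt[_ [G [[gG Gx] Ge] <-] lG]; exists G.
Qed.

Lemma avg_abs_leE f G (m l : R) : (0 < m)%R -> mu G = m%:E ->
  (avg_abs mu f G <= l%:E) = (\int[mu]_(x in G) `|f x|%:E <= l%:E * mu G).
Proof.
by move=> m0 Gm; rewrite /avg_abs Gm inver gt_eqF// lee_pdivrMl// muleC.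
Qed.

Lemma measurable_deviation f G c t : measurable G -> measurable_fun [set: T] f ->
  measurable [set x | G x /\ (t < `|f x - c|)%R].
Proof.
move=> mG mf.
have mfc : measurable_fun G (fun x => `|f x - c|)%R.
  apply: measurable_funTS; apply: measurableT_comp => //.
  exact: measurable_funB.
have -> : [set x | G x /\ (t < `|f x - c|)%R] =
    G `&` (fun x => `|f x - c|)%R @^-1` `]t, +oo[.
  by apply/seteqP; split => x /=; rewrite in_itv/= andbT.
exact: mfc.
Qed.

Hypothesis GG_gen : GG `<=` finite_positive mu.

Lemma generator_measure G : GG G -> exists2 m : R, (0 < m)%R & mu G = m%:E.
Proof.
move=> /GG_gen[_ G0 Goo].
have Gfin : mu G \is a fin_num by rewrite ge0_fin_numE.
by exists (fine (mu G)); rewrite ?fine_gt0 ?fineK ?G0.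
Qed.

Lemma integrable_generator f G : L1loc mu GG f -> GG G ->
  mu.-integrable G (EFin \o f).
Proof.
move=> [mf ifin] gG; apply/integrableP; split; last exact: ifin.
by apply/measurable_EFinP; apply: measurable_funTS.
Qed.

Lemma L1loc_cst c : L1loc mu GG (cst c).
Proof.
split=> // G gG; have [mG _ _] := GG_gen gG; have [m _ Gm] := generator_measure gG.
by rewrite (integral_cst mu mG `|c|%:E) Gm -EFinM ltry.
Qed.

Lemma L1loc_subc f c : L1loc mu GG f -> L1loc mu GG (fun x => f x - c)%R.
Proof.
move=> lf; split; first by apply: measurable_funB => //; case: lf.
move=> G gG; have [mG _ _] := GG_gen gG.
have /integrableP[_] := integrableB mG (integrable_generator lf gG)
  (integrable_generator (L1loc_cst c) gG).
by [].
Qed.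

Lemma avg_dist_le f G c : L1loc mu GG f -> GG G ->
  `|avg mu f G - c|%:E * mu G <= \int[mu]_(x in G) `|f x - c|%:E.
Proof.
move=> lf gG; have [mG _ _] := GG_gen gG; have [m m0 Gm] := generator_measure gG.
have ifc := integrable_generator (L1loc_subc c lf) gG.
have -> : `|avg mu f G - c|%:E * mu G = `|\int[mu]_(x in G) (f x - c)|%R%:E.
  rewrite RintegralB//; last 2 first.
  - exact: integrable_generator.
  - exact: (integrable_generator (L1loc_cst c)).
  rewrite Rintegral_cst// /avg Gm/= -EFinM; congr EFin.
  rewrite -[X in (_ * X = _)%R](gtr0_norm m0) -normrM mulrBl mulrC.
  by rewrite mulVKf ?gt_eqF.
rewrite EFin_normr_Rintegral//.
by apply: le_abse_integral => //; case/integrableP: ifc.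
Qed.

(** The means over [G] and [G'] differ by at most [b * B], because the
    oscillation over [G'] bounds the integral over the smaller set [G].
    Adding this to the oscillation over [G'] gives [(1 + b) * B * mu G'],
    and the remaining factor [b] comes from [mu G' <= b * mu G]. *)
Lemma double_oscillation f G G' (b B : R) : (0 <= B)%R -> (0 <= b)%R ->
  L1loc mu GG f ->
  (forall H, GG H -> \int[mu]_(x in H) `|f x - avg mu f H|%:E <= B%:E * mu H) ->
  GG G -> GG G' -> G `<=` G' -> mu G' <= b%:E * mu G ->
  \int[mu]_(x in G') `|f x - avg mu f G|%:E <= (b * (1 + b) * B)%:E * mu G.
Proof.
move=> B0 b0 lf osc gG gG' GG' leG'.
have [mG _ _] := GG_gen gG; have [m m0 Gm] := generator_measure gG.
have [mG' _ _] := GG_gen gG'; have [m' m0' Gm'] := generator_measure gG'.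
have mabs c : measurable_fun G' (fun x => `|f x - c|%:E).
  apply/measurable_EFinP; apply: measurable_funTS; apply: measurableT_comp => //.
  by apply: measurable_funB => //; case: lf.
have lem' : (m' <= b * m)%R by move: leG'; rewrite Gm Gm' -EFinM lee_fin.
have dist : (`|avg mu f G - avg mu f G'| <= b * B)%R.
  have : `|avg mu f G - avg mu f G'|%:E * mu G <= B%:E * mu G'.
    apply: le_trans (avg_dist_le _ lf gG) _; apply: le_trans (osc _ gG').
    by apply: ge0_subset_integral.
  rewrite Gm Gm' -!EFinM lee_fin => le1.
  rewrite -(ler_pM2r m0) (le_trans le1)//.
  by rewrite (mulrC b) -mulrA ler_wpM2l.
apply: (@le_trans _ _ (\int[mu]_(x in G')
   (`|f x - avg mu f G'|%:E + (cst (b * B)%:E) x))).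
  apply: ge0_le_integral => //.
  - by apply: emeasurable_funD.
  - move=> x _; rewrite -EFinD lee_fin.
    have -> : (f x - avg mu f G = (f x - avg mu f G') - (avg mu f G - avg mu f G'))%R.
      by rewrite opprB addrA subrK.
    by rewrite (le_trans (ler_normB _ _))// lerD2l.
rewrite ge0_integralD//; last by move=> x _; rewrite lee_fin mulr_ge0.
rewrite integral_cst//; apply: le_trans (leeD (osc _ gG') (lexx _)) _.
rewrite Gm Gm' -!EFinM -EFinD lee_fin -mulrDl.
have -> : (b * (1 + b) * B * m = (B + b * B) * (b * m))%R by lra.
by rewrite ler_wpM2l// addr_ge0// mulr_ge0.
Qed.

End oscillation.

(** * Decay of the deviation sets *)

Section decay.
Context {d : measure_display} {T : measurableType d} {R : realType}.
Variables (mu : {measure set T -> \bar R}) (GG : set (set T)) (a b : R).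
Hypotheses (GG_gen : GG `<=` finite_positive mu).
Hypotheses (a1 : (1 < a)%R) (ab : (a <= b)%R).
Hypotheses (dbl : Denjoy_doubling mu GG a b) (gr : growth mu GG a b).
Hypothesis wd : weak_differentiation mu GG.
Variables (f : T -> R) (B : R).
Hypotheses (lf : L1loc mu GG f) (B0 : (0 <= B)%R).
Hypothesis osc :
  forall G, GG G -> \int[mu]_(x in G) `|f x - avg mu f G|%:E <= B%:E * mu G.
Implicit Types (G : set T).

Let deviation G (t : R) := [set x | G x /\ (t < `|f x - avg mu f G|)%R].

(** The sets [C n] are selected stopping generators for the level [l] and
    [E n] is the double of [C n] (both empty once the selection runs out).
    The two halves of the stopping condition serve different purposes: the
    large mean over [C n] bounds [mu (C n)] by an integral over disjoint sets,
    and the small mean over [E n] keeps the mean of [f] there close to the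
    mean over [G0]. *)
Lemma calderon_zygmund_cover G0 (l : R) : GG G0 ->
  (b ^+ 2 * (1 + b) * B <= l)%R -> (0 <= l)%R ->
  exists (C E : nat -> set T) (N : set T),
  [/\ trivIset [set: nat] C,
      mu.-negligible N,
      \int[mu]_(x in \bigcup_n C n) `|f x - avg mu f G0|%:E
        <= (b * (1 + b) * B)%:E * mu G0,
      deviation G0 l `<=` N `|` \bigcup_n E n &
      forall n, measurable (C n) /\
       ((C n = set0 /\ E n = set0) \/ [/\ GG (E n),
        mu (E n) <= b%:E * mu (C n),
        l%:E * mu (C n) <= \int[mu]_(x in C n) `|f x - avg mu f G0|%:E &
        (`|avg mu f (E n) - avg mu f G0| <= l)%R])].
Proof.
move=> gG0 Bl l0.
have a0 : (0 < a)%R by exact: lt_trans a1.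
have b0 : (0 < b)%R by exact: lt_le_trans ab.
set c := avg mu f G0; pose g x := (f x - c)%R.
have lg : L1loc mu GG g by exact: L1loc_subc.
have /choice[D DP] : forall G, exists G', GG G -> Denjoy_double mu GG a b G G'.
  move=> G; have [/dbl[G' dG]|nG] := pselect (GG G); first by exists G'.
  by exists G.
have gD G : GG G -> GG (D G) by move=> /DP[].
have [m0 m00 G0m] := generator_measure GG_gen gG0.
have [mG0 _ _] := GG_gen gG0.
have [mH _ Hoo] := GG_gen (gD _ gG0).
have [_ _ DG0b] := DP _ gG0.
have mabs A : measurable_fun A (fun x => `|f x - c|%:E).
  apply/measurable_EFinP; apply: measurable_funTS; apply: measurableT_comp => //.
  by apply: measurable_funB => //; case: lf.
have oscH : \int[mu]_(x in D G0) `|f x - c|%:E <= (b * (1 + b) * B)%:E * mu G0.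
  apply: (double_oscillation GG_gen) => //; first exact: ltW.
    exact: gD.
  exact: (subset_double a1 GG_gen DP).
pose P G := l%:E * mu G < \int[mu]_(x in G) `|f x - c|%:E.
(* Generators of measure comparable to [mu G0] lie in the double of [G0] and
   have mean at most [b ^ 2 * (1 + b) * B]. *)
have nP_large G : GG G -> G `&` G0 !=set0 ->
    (a / b)%:E * mu G0 <= mu G -> mu G <= a%:E * mu G0 -> ~ P G.
  move=> gG GG0 Gge Gle; apply/negP; rewrite -leNgt.
  have [mG _ _] := GG_gen gG; have [m m_0 Gm] := generator_measure GG_gen gG.
  apply: (@le_trans _ _ (\int[mu]_(x in D G0) `|f x - c|%:E)).
    apply: ge0_subset_integral => //.
    exact: (small_subset_double GG_gen DP).
  apply: le_trans oscH _.
  move: Gge; rewrite Gm G0m -!EFinM !lee_fin => Gge.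
  apply: (@le_trans _ _ ((b ^+ 2 * (1 + b) * B) * m)%R); last first.
    by rewrite ler_wpM2r// ltW.
  have -> : (b ^+ 2 * (1 + b) * B * m = b * (1 + b) * B * (b * m))%R by lra.
  rewrite ler_wpM2l//; first by rewrite !mulr_ge0 ?addr_ge0 ?(ltW b0).
  move: Gge; rewrite mulrAC ler_pdivrMr// [in X in X -> _](mulrC m).
  by apply: le_trans; rewrite ler_peMl ?ltW.
pose F := [set G | [/\ GG G, G `<=` D G0, P G & ~ P (D G)]].
have Fprop G : F G -> [/\ measurable G, 0 < mu G & G `<=` D G0].
  by move=> [gG GH _ _]; have [mG G_0 _] := GG_gen gG.
have [C [tC FC Ccov]] := vitali_selection a1 mH Hoo Fprop.
have mC n : measurable (C n) by case: (FC n) => [/Fprop[]//|->].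
have [N [mN N0 wdN]] := wd lg.
pose E n := if pselect (F (C n)) then D (C n) else set0.
exists C, E, N; split => //.
- exact/negligibleP.
- apply: le_trans oscH; apply: ge0_subset_integral => //.
    exact: bigcup_measurable.
  by move=> x [n _ Cx]; case: (FC n) => [[_ /(_ x Cx)]//|Cn0]; rewrite Cn0 in Cx.
(* Covering: from a point of large deviation to a small generator, then to a
   stopping generator, then to the double of a selected one. *)
- move=> x [G0x lx].
  have [Nx|nNx] := pselect (N x); first by left.
  right; have : `|g x|%:E <= limsup_avg_abs mu GG g x.
    by apply: contrapT => /wdN.
  move=> /(lt_le_trans _) lsup.
  have [||G [gG Gx Gsmall lG]] := @limsup_avg_abs_gt _ _ _ mu GG g x l (a / b * m0).
  + by rewrite mulr_gt0// divr_gt0.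
  + by apply: lsup; rewrite lte_fin.
  have PG : P G.
    have [m m_0 Gm] := generator_measure GG_gen gG.
    by rewrite /P ltNge -(avg_abs_leE _ _ m_0 Gm) -ltNge.
  have [||G1 [gG1 GG1 G1small PG1 nPDG1]] :=
      stopping_double a1 ab GG_gen DP gr gG0 gG _ _ PG nP_large.
  + by exists x.
  + by rewrite G0m -EFinM.
  have G1le : mu G1 <= a%:E * mu G0.
    apply: le_trans G1small _; rewrite lee_wpmul2r// lee_fin.
    by rewrite ler_pdivrMr// ler_peMr ?ltW// (lt_le_trans a1).
  have G1H : G1 `<=` D G0.
    apply: (small_subset_double GG_gen DP gG0 gG1) => //.
    by exists x; split=> //; exact: GG1.
  have [n [FCn G1C G1Cle]] : exists n,
      [/\ F (C n), G1 `&` C n !=set0 & mu G1 <= a%:E * mu (C n)] by exact: Ccov.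
  exists n => //; rewrite /E; case: pselect => //= _.
  have [gCn _ _ _] := FCn.
  by apply: (small_subset_double GG_gen DP gCn gG1) => //; apply: GG1.
- move=> n; split => //; rewrite /E.
  case: pselect => [[gCn CnH PC nPD]|nF]; last first.
    by left; split => //; case: (FC n).
  have gDC := gD _ gCn; have [_ _ DCb] := DP _ gCn.
  right; split => //; first exact: ltW.
  have [m m_0 Gm] := generator_measure GG_gen gDC.
  rewrite -lee_fin -(@lee_pmul2r _ m%:E)// -Gm.
  apply: le_trans (avg_dist_le GG_gen c lf gDC) _.
  by rewrite leNgt; apply/negP.
Qed.

(** Outside a null set a deviation beyond [s + l] on [G] lies in some [E n]
    and is a deviation beyond [s] from the mean over [E n].  Summing the
    assumed bound over [n] costs the factor
    [b / l * (b * (1 + b) * B)], which is at most [1 / 2] by the choice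
    of [l]. *)
Lemma deviation_step (k l s : R) : (0 <= k)%R -> (0 < l)%R ->
  (2 * b ^+ 2 * (1 + b) * B <= l)%R -> (0 <= s)%R ->
  (forall G, GG G -> mu (deviation G s) <= k%:E * mu G) ->
  forall G, GG G -> mu (deviation G (s + l)) <= (k / 2)%:E * mu G.
Proof.
move=> k0 l0 Bl s0 kP G gG.
have b0 : (0 < b)%R by rewrite (lt_le_trans _ ab)// (lt_trans _ a1).
have c0 : (0 <= b ^+ 2 * (1 + b) * B)%R.
  by rewrite !mulr_ge0 ?exprn_ge0 ?addr_ge0 ?(ltW b0).
have [|C [E [N [tC [N' [mN' N'0 NN']] intC cov CE]]]] :=
    @calderon_zygmund_cover G l gG _ (ltW l0).
  by apply: le_trans Bl; rewrite -!mulrA mulrA in c0 *; lra.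
have mf : measurable_fun [set: T] f by case: lf.
have [mG _ _] := GG_gen gG.
have [m m0 Gm] := generator_measure GG_gen gG.
have mE n : measurable (deviation (E n) s).
  have [_ [[_ ->]|[/GG_gen[mE _ _] _ _ _]]] := CE n.
    by rewrite (_ : deviation _ _ = set0)// -subset0 => x [].
  exact: measurable_deviation.
have mC n : measurable (C n) by case: (CE n).
set I := fun A => \int[mu]_(x in A) `|f x - avg mu f G|%:E in intC CE *.
have I0 A : 0 <= I A by apply: integral_ge0.
have Ebound n : mu (deviation (E n) s) <= (k * b / l)%:E * I (C n).
  have [_ [[-> ->]|[gE Eb lC _]]] := CE n.
    rewrite (_ : deviation _ _ = set0) ?measure0; last by rewrite -subset0 => x [].
    by rewrite mule_ge0// lee_fin !mulr_ge0 ?invr_ge0 ?(ltW b0) ?(ltW l0).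
  apply: le_trans (kP _ gE) _.
  rewrite -mulrA EFinM -muleA lee_wpmul2l ?lee_fin//.
  apply: le_trans Eb _.
  by rewrite EFinM -muleA lee_wpmul2l ?lee_fin ?(ltW b0)// lee_pdivlMl.
have sub : deviation G (s + l) `<=` \bigcup_n deviation (E n) s `|` N'.
  move=> x [Gx dx].
  have [|/NN'|[n _ Ex]] := cov x.
  - by split=> //; apply: le_lt_trans dx; rewrite lerDr.
  - by right.
  left; exists n => //; split => //.
  have [_ [[_ E0]|[_ _ _ dist]]] := CE n; first by rewrite E0 in Ex.
  rewrite -(ltrD2r l) (lt_le_trans dx)//.
  apply: le_trans (lerD (lexx _) dist).
  by rewrite (le_trans _ (ler_normD _ _))// addrA subrK.
apply: (@le_trans _ _ (mu (\bigcup_n deviation (E n) s `|` N'))).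
  apply: le_measure; rewrite ?inE//; first exact: measurable_deviation.
  by apply: measurableU => //; exact: bigcup_measurable.
rewrite measureU0//; last exact: bigcup_measurable.
apply: (@le_trans _ _ (\sum_(i <oo) mu (deviation (E i) s))).
  by apply: generalized_Boole_inequality => //; exact: bigcup_measurable.
apply: (@le_trans _ _ (\sum_(i <oo) (k * b / l)%:E * I (C i))).
  by apply: lee_nneseries.
rewrite nneseriesZl// -ge0_integral_bigcup//; last first.
  apply/measurable_EFinP; apply: measurable_funTS; apply: measurableT_comp => //.
  exact: measurable_funB.
have kbl : (0 <= k * b / l)%R by rewrite !mulr_ge0 ?invr_ge0 ?(ltW b0) ?(ltW l0).
apply: le_trans (lee_wpmul2l _ intC) _; first by rewrite lee_fin.
rewrite muleA -EFinM lee_wpmul2r// lee_fin.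
rewrite mulrAC ler_pdivrMr//.
have -> : (k * b * (b * (1 + b) * B) = k / 2 * (2 * b ^+ 2 * (1 + b) * B))%R by lra.
by rewrite ler_wpM2l// divr_ge0.
Qed.

Lemma deviation_decay (l : R) n : (0 < l)%R ->
  (2 * b ^+ 2 * (1 + b) * B <= l)%R ->
  forall t G, (l *+ n <= t)%R -> GG G ->
  mu (deviation G t) <= (2^-1 ^+ n)%:E * mu G.
Proof.
move=> l0 Bl; elim: n => [|n IH] t G lt gG.
  have [mG _ _] := GG_gen gG.
  rewrite expr0 mul1e; apply: le_measure; rewrite ?inE//.
    by apply: measurable_deviation => //; case: lf.
  by move=> x [].
rewrite exprSr -(subrK l t).
have lt' : (l *+ n <= t - l)%R by rewrite lerBrDr -mulrSr.
apply: deviation_step => //.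
- by rewrite (le_trans _ lt')// mulrn_wge0// ltW.
- by move=> G1 gG1; apply: IH.
Qed.

End decay.

Theorem theorem1p2 (d : measure_display) (T : measurableType d)
    (R : realType) (mu : {measure set T -> \bar R}) (GG : set (set T))
    (mu_nontrivial : 0 < mu [set: T]) (mu_semifinite : semifinite mu)
    (GG_generators : generators mu GG) (GG_Denjoy : Denjoy_family mu GG) :
  John_Nirenberg mu GG.
Proof.
have [GG_gen _] := GG_generators.
have [_ [a [b [a1 ab dbl gr]]] wd] := GG_Denjoy.
have b0 : (0 < b)%R by rewrite (lt_le_trans _ ab)// (lt_trans _ a1).
set K := (2 * b ^+ 2 * (1 + b))%R.
have K0 : (0 < K)%R by rewrite !mulr_gt0 ?exprn_gt0 ?addr_gt0.
exists 2%R, (ln 2 / K)%R; split => //; first by rewrite divr_gt0// ln_gt0// ltr1n.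
move=> f [lf normoo] G gG t t0.
have [m m0 Gm] := generator_measure GG_gen gG.
have [mG _ _] := GG_gen _ gG.
have norm0 : 0 <= BMO_norm mu GG f.
  apply: (@le_trans _ _ (avg_abs mu (fun x => f x - avg mu f G)%R G)).
    by rewrite mule_ge0 ?inve_ge0 ?integral_ge0.
  by apply: ereal_sup_ubound; exists G.
set B := fine (BMO_norm mu GG f).
have normE : BMO_norm mu GG f = B%:E by rewrite fineK// ge0_fin_numE.
have B0 : (0 <= B)%R by rewrite -lee_fin -normE.
have osc H : GG H -> \int[mu]_(x in H) `|f x - avg mu f H|%:E <= B%:E * mu H.
  move=> gH; have [h h0 Hh] := generator_measure GG_gen gH.
  rewrite -(avg_abs_leE _ _ h0 Hh) -normE.
  by apply: ereal_sup_ubound; exists H.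
have decay := deviation_decay GG_gen a1 ab dbl gr wd lf B0 osc.
rewrite normE eqe Gm inver gt_eqF//.
(* When the norm vanishes every positive step length is admissible in the
   decay estimate, so [n] steps of length [t / n.+1] give the bound [2 ^- n]
   for all [n]. *)
have [B_0|Bn0] := eqVneq B 0%R.
  rewrite muleC lee_pdivrMl// mule0.
  apply/lee_addgt0Pr => e e0; rewrite add0e.
  have [n ne] : exists n, (2^-1 ^+ n * m < e)%R.
    exists (Num.truncn (m / e)).+1.
    rewrite exprVn mulrC ltr_pdivrMr ?exprn_gt0// mulrC -ltr_pdivrMr//.
    apply: lt_trans (truncnS_gt _) _.
    by rewrite -natrX ltr_nat ltn_expl.
  apply: le_trans (decay (t / n.+1%:R)%R n _ _ t G _ gG) _.
  - by rewrite divr_gt0.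
  - by rewrite B_0 mulr0 divr_ge0// ltW.
  - rewrite -[X in (X <= _)%R]mulr_natr mulrAC ler_pdivrMr// ler_wpM2l ?ltW//.
    by rewrite ltr_nat.
  by rewrite Gm -EFinM lee_fin ltW.
have {B0 Bn0}B0 : (0 < B)%R by rewrite lt_neqAle eq_sym Bn0.
rewrite muleC lee_pdivrMl//.
have l0 : (0 < K * B)%R by rewrite mulr_gt0.
(* With [n] the integer part of [t / (K * B)], rounding down costs at most
   the factor [c1 = 2]. *)
pose n := Num.truncn (t / (K * B)).
have [nlet tlen] : (n%:R <= t / (K * B) /\ t / (K * B) < n.+1%:R)%R.
  by rewrite /n truncn_le ?truncnS_gt ?divr_ge0 ?ltW.
apply: le_trans (decay (K * B)%R n l0 (lexx _) t G _ gG) _.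
  by rewrite -[X in (X <= _)%R]mulr_natl -ler_pdivlMr.
rewrite Gm muleC -EFinM lee_fin ler_wpM2l ?(ltW m0)//.
have -> : (- (ln 2 / K) / B * t = - ln 2 * (t / (K * B)))%R.
  by rewrite (invfM K B); ring.
have ln20 : (0 < ln 2 :> R)%R by rewrite ln_gt0// ltr1n.
rewrite -[X in (X * expR _)%R]lnK ?posrE// -expRD.
rewrite -[X in (X ^+ _)%R]lnK ?posrE ?invr_gt0// -expRM_natl ler_expR.
rewrite lnV ?posrE//; move: tlen; rewrite -natr1; nra.
Qed.
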